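(* Let $R$ be a finite commutative ring, $V$ a finite $R$-module, $Q$ a probability on $R$, $P$ the uniform distribution on $V$, and $\alpha\in[0,1]$. For a cyclic submodule $W$ of $V$ and a character $\rho$ of $U(R)$ that factors through $\pi_W\colon U(R)\to U(R/\mathrm{ann}(W))$, define \[\lambda_{([W],\rho)}=\begin{cases}1,&W=0,\\(1-\alpha)\sum_{a\in U(R)+\mathrm{ann}(W)}Q(a)\rho(u_W(a)),&W\neq0,\end{cases}\] where $u_W(a)\in U(R)$ satisfies $u_W(a)+\mathrm{ann}(W)=a+\mathrm{ann}(W)$. Then the multiset of eigenvalues of the transition matrix of the coin-toss walk on $V$ (driven by $P$ and $Q$, heads probability $\alpha$) is obtained by taking, for each isomorphism class $[W]$ of cyclic submodules of $V$ and each such $\rho$, the value $\lambda_{([W],\rho)}$ with multiplicity equal to the number of cyclic submodules of $V$ isomorphic to $W$.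
   Context: $U(S)$: unit group of a ring $S$ (the zero ring has trivial unit group); $\mathrm{ann}(W)=\{r\in R: rW=0\}$; $\pi_W$ is the natural map (which is surjective, so $u_W(a)$ exists and $\lambda$ does not depend on its choice). The transition matrix has $(x,y)$-entry the probability of moving from $x$ to $y$. Coin-toss walk: from $x\in V$, with probability $\alpha$ move to $x+b$ ($b$ chosen by $P$), with probability $1-\alpha$ move to $ax$ ($a$ chosen by $Q$). *)

(* Defs.v *)
From HB Require Import structures.
From mathcomp Require Import all_boot all_order all_fingroup all_algebra.
From mathcomp Require Import cyclic generic_quotient ring_quotient.
From mathcomp Require Import finmap.
From mathcomp Require Import boolp classical_sets cardinality reals.
From mathcomp Require Import complex.

Set Implicit Arguments.
Unset Strict Implicit.
Unset Printing Implicit Defensive.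

Import Order.TTheory GRing.Theory Num.Theory.
Local Open Scope ring_scope.
Local Open Scope quotient_scope.
Local Open Scope complex_scope.

(* The library's [finLmodType] is over a nontrivial ring, and Hierarchy Builder
   rejects the same structure over a [pzRingType]. *)
Record finModType (R : pzRingType) := FinModType {
  fm_module : lmodType R;
  fm_enum : seq fm_module;
  fm_enumP : Finite.axiom fm_enum
}.

Definition fm_sort (R : pzRingType) (M : finModType R) : Type := fm_module M.
Coercion fm_sort : finModType >-> Sortclass.

Section FiniteModule.
Variables (R : pzRingType) (M : finModType R).

HB.instance Definition _ := GRing.Lmodule.copy M (fm_module M).

Lemma fm_pickleK :
  pcancel (fun x : M => index x (fm_enum M)) (fun n => onth (fm_enum M) n).
Proof.
move=> x; have ex : x \in fm_enum M by rewrite -has_pred1 has_count fm_enumP.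
by rewrite /= onthE (nth_map (0 : M)) ?index_mem // nth_index.
Qed.

HB.instance Definition _ := PCanIsCountable fm_pickleK.
HB.instance Definition _ := isFinite.Build M (@fm_enumP R M).

End FiniteModule.

(* [GRing.unit] and [{unit S}] require a nontrivial ring with a chosen inverse;
   the unit group below also makes sense for the zero ring, which occurs as
   R / ann(0). *)
Section UnitGroup.
Variable S : finComPzRingType.

Definition is_unit (x : S) : bool := [exists y, x * y == 1].

Record ugroup : predArgType := UGroup { uval :> S; _ : is_unit uval }.

HB.instance Definition _ := [isSub for uval].
HB.instance Definition _ := [Finite of ugroup by <:].

Lemma is_unitP (x : S) : reflect (exists y, x * y = 1) (is_unit x).
Proof. by apply: (iffP existsP) => -[y /eqP]; exists y => //; apply/eqP. Qed.

Lemma is_unit1 : is_unit 1.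
Proof. by apply/is_unitP; exists 1; rewrite mulr1. Qed.

Lemma is_unitM (u v : ugroup) : is_unit (uval u * uval v).
Proof.
case: u v => [x /is_unitP[x' xx']] [y /is_unitP[y' yy']] /=.
by apply/is_unitP; exists (x' * y'); rewrite mulrACA xx' yy' mulr1.
Qed.

Lemma uinv_subproof (u : ugroup) : exists v : ugroup, uval v * uval u == 1.
Proof.
case: u => [x /is_unitP[y xy]] /=.
have hy : is_unit y by apply/is_unitP; exists x; rewrite mulrC.
by exists (UGroup hy); rewrite /= mulrC xy.
Qed.

Definition uone : ugroup := UGroup is_unit1.
Definition umul (u v : ugroup) : ugroup := UGroup (is_unitM u v).
Definition uinv (u : ugroup) : ugroup := xchoose (uinv_subproof u).

Lemma umulA : associative umul.
Proof. by move=> u v w; apply: val_inj; rewrite /= mulrA. Qed.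

Lemma umul1 : left_id uone umul.
Proof. by move=> u; apply: val_inj; rewrite /= mul1r. Qed.

Lemma umulV : left_inverse uone uinv umul.
Proof.
by move=> u; apply: val_inj; rewrite /=; apply/eqP/(xchooseP (uinv_subproof u)).
Qed.

HB.instance Definition _ := Finite_isGroup.Build ugroup umulA umul1 umulV.

End UnitGroup.

Notation "''U' ( S )" := (ugroup S)
  (at level 8, format "''U' ( S )") : type_scope.

Definition is_character (G : finGroupType) (C : fieldType) (chi : G -> C) : Prop :=
  chi 1%g = 1 /\ forall x y, chi (x * y)%g = chi x * chi y.

Lemma finite_characters (G : finGroupType) (C : closedFieldType) :
  finite_set [set chi : {ffun G -> C} | is_character chi]%classic.
Proof.
have G0 : (0 < #|G|)%N by apply/card_gt0P; exists 1%g.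
have [s Ds] := closed_field_poly_normal ('X^#|G| - 1 : {poly C}).
have rootsP (x : C) : x ^+ #|G| = 1 -> x \in s.
  move=> xn; rewrite -root_prod_XsubC.
  have <- : 'X^#|G| - 1 = \prod_(z <- s) ('X - z%:P) :> {poly C}.
    by rewrite Ds lead_coefDl ?lead_coefXn ?scale1r // size_polyXn
              size_polyN size_poly1.
  by rewrite rootE !hornerE xn subrr.
pose f (g : {ffun G -> seq_sub s}) := [ffun x => ssval (g x)] : {ffun G -> C}.
apply: (@sub_finite_set _ _ (f @` setT)); last first.
  exact/finite_image/finite_finset.
move=> chi [chi1 chiM] /=.
have chiX x n : chi (x ^+ n)%g = chi x ^+ n.
  by elim: n => [|n IH]; rewrite ?expg0 ?expr0 // expgS chiM IH exprS.
have chis x : chi x \in s.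
  by apply: rootsP; rewrite -chiX -cardsT expg_cardG ?inE.
exists [ffun x => SeqSub (chis x)] => //.
by apply/ffunP => x; rewrite !ffunE.
Qed.

Section Annihilator.
Variables (R : finComPzRingType) (V : finModType R).
Implicit Type W : {set V}.

Definition ann W : {pred R} := fun r => [forall w in W, r *: w == 0].

Lemma annP W r : reflect (forall w, w \in W -> r *: w = 0) (r \in ann W).
Proof. by apply: (iffP forall_inP) => h w /h /eqP. Qed.

Lemma ann_zmod_closed W : zmod_closed (ann W).
Proof.
split=> [|a b /annP ha /annP hb]; apply/annP => w Ww; first by rewrite scale0r.
by rewrite scalerBl ha // hb // subrr.
Qed.

HB.instance Definition _ W :=
  GRing.isZmodClosed.Build R (ann W) (ann_zmod_closed W).

Lemma annMr W a b : b \in ann W -> a * b \in ann W.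
Proof. by move=> /annP h; apply/annP => w Ww; rewrite -scalerA h // scaler0. Qed.

(* [{ideal_quot I}] provides a ring structure only for proper ideals, whereas
   ann(0) = R; only its additive part is reused. *)
Definition quot_ann W := {ideal_quot (ann W)}.

Section QuotientRing.
Variable W : {set V}.
Local Notation Q := (quot_ann W).

HB.instance Definition _ := EqQuotient.on Q.
HB.instance Definition _ := GRing.Zmodule.on Q.
HB.instance Definition _ := ZmodQuotient.on Q.

Definition quot_repr (x : Q) : R := repr x.
Lemma quot_reprK : cancel quot_repr (\pi_Q : R -> Q).
Proof. exact: reprK. Qed.

HB.instance Definition _ : isCountable Q := CanIsCountable quot_reprK.
HB.instance Definition _ : isFinite Q := CanIsFinite quot_reprK.

Lemma quot_annP (a b : R) : reflect (\pi_Q a = \pi_Q b) (a - b \in ann W).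
Proof. by rewrite Quotient.idealrBE; apply: eqP. Qed.

Definition qone : Q := \pi_Q 1.
Definition qmul (x y : Q) : Q := \pi_Q (repr x * repr y).

Lemma pi_qmul a b : \pi_Q (a * b) = qmul (\pi_Q a) (\pi_Q b).
Proof.
rewrite /qmul; set a' := repr _; set b' := repr _.
have ha : a - a' \in ann W by apply/quot_annP; rewrite reprK.
have hb : b - b' \in ann W by apply/quot_annP; rewrite reprK.
apply/quot_annP; have -> : a * b - a' * b' = a * (b - b') + b' * (a - a').
  by rewrite !mulrBr addrA [b' * a]mulrC [b' * a']mulrC subrK.
by rewrite rpredD ?annMr.
Qed.

Lemma qmulA : associative qmul.
Proof.
move=> x y z; rewrite -[x]reprK -[y]reprK -[z]reprK; set a := repr x.
set b := repr y; set c := repr z.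
by rewrite -(pi_qmul b) -(pi_qmul a b) -(pi_qmul a) -(pi_qmul _ c) mulrA.
Qed.

Lemma qmulC : commutative qmul.
Proof. by move=> x y; rewrite /qmul mulrC. Qed.

Lemma qmul1 : left_id qone qmul.
Proof.
by move=> x; rewrite -[x]reprK; set a := repr x; rewrite -(pi_qmul 1) mul1r.
Qed.

Lemma qmulDl : left_distributive qmul +%R.
Proof.
move=> x y z; rewrite -[x]reprK -[y]reprK -[z]reprK; set a := repr x.
set b := repr y; set c := repr z.
by rewrite -raddfD -(pi_qmul a) -(pi_qmul b) -(pi_qmul _ c) mulrDl raddfD.
Qed.

HB.instance Definition _ :=
  GRing.Zmodule_isComPzRing.Build Q qmulA qmulC qmul1 qmulDl.

Lemma pi_ann_unit (u : 'U(R)) : is_unit (\pi_Q (uval u) : Q).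
Proof.
case: u => [x /is_unitP[y xy]] /=; apply/is_unitP; exists (\pi_Q y).
by rewrite -[LHS]pi_qmul xy.
Qed.

Definition pi_ann (u : 'U(R)) : 'U(Q) := UGroup (pi_ann_unit u).

End QuotientRing.

Definition units_plus_ann W : {set R} :=
  [set r | [exists u : 'U(R), [exists s in ann W, r == uval u + s]]].

Definition cyclic_submodules : {set {set V}} :=
  [set [set r *: v | r : R] | v : V].

(* A map W -> W' is represented by any of its extensions to V, so that the
   linearity and injectivity conditions only concern elements of W. *)
Definition submod_iso W W' : bool :=
  [exists f : {ffun V -> V},
    [&& f @: W == W',
        [forall x in W, forall y in W, (f x == f y) ==> (x == y)] &
        [forall r : R, forall x in W, forall y in W,
          f (r *: x + y) == r *: f x + f y]]].

Definition iso_copies W : {set {set V}} :=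
  [set W' in cyclic_submodules | submod_iso W W'].

Definition iso_classes : {set {set {set V}}} :=
  [set iso_copies W | W in cyclic_submodules].

Definition factors_through (C : fieldType) W (rho : 'U(R) -> C) : Prop :=
  exists sigma : 'U(quot_ann W) -> C,
    is_character sigma /\ forall u, rho u = sigma (pi_ann W u).

(* [fset_set A] has the elements of A when A is finite, which is the case here
   by [finite_characters]. *)
Definition characters_through (C : closedFieldType) W : {fset {ffun 'U(R) -> C}} :=
  fset_set [set rho : {ffun 'U(R) -> C} |
    is_character rho /\ factors_through W rho]%classic.

End Annihilator.

Section Walk.
Variable K : realType.

Definition is_probability (T : finType) (P : T -> K) : Prop :=
  (forall x, 0 <= P x) /\ \sum_x P x = 1.

Definition uniform (T : finType) : T -> K := fun=> #|T|%:R^-1.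

Variables (R : finComPzRingType) (V : finModType R).

Definition coin_toss (alpha : K) (P : V -> K) (Q : R -> K) (x y : V) : K :=
  alpha * (\sum_(b | x + b == y) P b)
  + (1 - alpha) * (\sum_(a | a *: x == y) Q a).

(* [char_poly] is only available for matrices indexed by ordinals; V is
   enumerated by [enum_val]. *)
Definition transition_matrix (alpha : K) (P : V -> K) (Q : R -> K) :
    'M[K[i]]_#|{: V}| :=
  \matrix_(i, j) (coin_toss alpha P Q (enum_val i) (enum_val j))%:C.

(* [u] plays the part of a |-> u_W(a). *)
Definition lambda (alpha : K) (Q : R -> K) (W : {set V}) (u : R -> 'U(R))
    (rho : {ffun 'U(R) -> K[i]}) : K[i] :=
  if W == [set 0]%SET then 1
  else (1 - alpha)%:C *
       \sum_(a in units_plus_ann W) (Q a)%:C * rho (u a).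

End Walk.

Arguments uniform K {T}.

(* The roots of the characteristic polynomial, with multiplicity, in an
   unspecified order. *)
Definition eigenvalues (C : closedFieldType) n (A : 'M[C]_n) : seq C :=
  sval (closed_field_poly_normal (char_poly A)).

(* Main.v *)
Require Import Defs.
From mathcomp Require Import classical_sets cardinality.
From mathcomp Require Import all_boot all_order all_fingroup all_algebra.
From mathcomp Require Import reals complex finmap generic_quotient.
Import Order.TTheory GRing.Theory Num.Theory.
Local Open Scope ring_scope.

Set Implicit Arguments.
Unset Strict Implicit.
Unset Printing Implicit Defensive.

(** Over a field of characteristic zero a finite multiset is determined by its
    power sums, so it suffices to compare the trace of the [n]-th power of the
    transition matrix with the [n]-th power sum of the proposed eigenvalues.

    Let [M] be the matrix of the pure multiplication walk. Its [n]-th power is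
    driven by the [n]-fold multiplicative convolution [Q_n] of [Q], and sorting
    the fixed points [a x = x] by the cyclic module [W] that [x] generates, its
    trace is the sum over [W] of the number of generators of [W] times
    [Q_n (1 + ann W)]. The uniform jumps are a rank one perturbation that only
    replaces the contribution [(1 - alpha)^n] of [W = 0] by [1].

    On the other side, a character [rho] through [pi_W], extended by zero outside
    [U(R) + ann W], is multiplicative on [R], so the [n]-th power of its
    [Q]-average is its [Q_n]-average. Summing over [rho], orthogonality of the
    characters of [U(R / ann W)], a group with as many elements as [W] has
    generators, gives the same number. *)

(** * Multisets determined by power sums *)

(** By linearity, equal power sums give equal sums of [p.[x]] for every polynomial [p]. A [p] that
    vanishes at every entry other than [z] isolates the multiplicity of [z]. *)
Lemma perm_eq_power_sums (F : numFieldType) (s t : seq F) :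
  (forall n, \sum_(x <- s) x ^+ n = \sum_(x <- t) x ^+ n) -> perm_eq s t.
Proof.
move=> st; apply/allP => z _ /=; apply/eqP.
have horner_st (p : {poly F}) : \sum_(x <- s) p.[x] = \sum_(x <- t) p.[x].
  under eq_bigr do rewrite horner_coef.
  under [RHS]eq_bigr do rewrite horner_coef.
  rewrite exchange_big [RHS]exchange_big /=; apply: eq_bigr => i _.
  by rewrite -!mulr_sumr st.
pose p := \prod_(y <- undup (s ++ t) | y != z) ('X - y%:P).
have p0 x : x \in s ++ t -> x != z -> p.[x] = 0.
  move=> xst xz; rewrite /p horner_prod (big_rem x) ?mem_undup //= xz.
  by rewrite !hornerE subrr mul0r.
have pz : p.[z] != 0.
  rewrite /p horner_prod prodf_seq_neq0; apply/allP => y _.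
  by apply/implyP => yz; rewrite !hornerE subr_eq0 eq_sym.
have count_st (r : seq F) : {subset r <= s ++ t} ->
    \sum_(x <- r) p.[x] = p.[z] *+ count_mem z r.
  move=> rst; rewrite -iter_addr_0 -big_const_seq [RHS]big_mkcond /= !big_seq.
  apply: eq_bigr => x xr; case: eqVneq => [->//|xz].
  by rewrite p0 ?rst.
have := horner_st p; rewrite !count_st => [|x xt|x xs]; last first.
- by rewrite mem_cat xs.
- by rewrite mem_cat xt orbT.
(* Characteristic zero: a multiple of the nonzero [p.[z]] determines its coefficient in the
   naturals. *)
by move=> /(mulrIn pz).
Qed.

(** * Triangularisation: traces of powers as power sums of eigenvalues *)

Section Trigonal.
Variables (C : numClosedFieldType) (n : nat).
Implicit Types A B : 'M[C]_n.

Lemma mulmx_trig_diag A B i :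
  is_trig_mx A -> is_trig_mx B -> (A *m B) i i = A i i * B i i.
Proof.
move=> /is_trig_mxP At /is_trig_mxP Bt; rewrite mxE (bigD1 i) //= big1 ?addr0 //.
move=> j; rewrite -val_eqE neq_ltn => /orP[ji|ij].
  by rewrite Bt ?mulr0.
by rewrite At ?mul0r.
Qed.

Lemma mulmx_trig A B : is_trig_mx A -> is_trig_mx B -> is_trig_mx (A *m B).
Proof.
move=> /is_trig_mxP At /is_trig_mxP Bt; apply/is_trig_mxP => i j ij.
rewrite mxE big1 // => k _; have [ik|ki] := ltnP i k; first by rewrite At ?mul0r.
by rewrite Bt ?mulr0 // (leq_ltn_trans ki).
Qed.

Lemma expr_trig A k : is_trig_mx A ->
  is_trig_mx (A ^+ k) /\ forall i, (A ^+ k) i i = A i i ^+ k.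
Proof.
move=> At; elim: k => [|k [tk dk]].
  by split=> [|i]; [exact: scalar_mx_is_trig | rewrite mxE eqxx].
rewrite exprS; split=> [|i]; first exact: mulmx_trig.
by rewrite mulmx_trig_diag // dk exprS.
Qed.

Lemma char_poly_conj P A : P \in unitmx ->
  char_poly (P *m A *m invmx P) = char_poly A.
Proof.
move=> Pu; rewrite /char_poly /char_poly_mx.
have -> : 'X%:M - map_mx polyC (P *m A *m invmx P) =
    map_mx polyC P *m ('X%:M - map_mx polyC A) *m map_mx polyC (invmx P).
  rewrite mulmxBr mulmxBl !map_mxM /=; congr (_ - _).
  by rewrite scalar_mxC -mulmxA -map_mxM mulmxV // map_mx1 mulmx1.
by rewrite !det_mulmx mulrAC -det_mulmx -map_mxM mulmxV // map_mx1 det1 mul1r.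
Qed.

Lemma expr_conj P A k : P \in unitmx ->
  (P *m A *m invmx P) ^+ k = P *m A ^+ k *m invmx P.
Proof.
move=> Pu; elim: k => [|k IH]; first by rewrite !expr0 mulmx1 mulmxV.
by rewrite !exprS IH -!mulmxE !mulmxA mulmxKV.
Qed.

Lemma mxtrace_conj P A : P \in unitmx -> \tr (P *m A *m invmx P) = \tr A.
Proof. by move=> Pu; rewrite mxtrace_mulC mulmxA mulVmx // mul1mx. Qed.

(** A triangular conjugate [D] of [A] has the eigenvalues of [A] on its diagonal, and powers of [D]
    act entrywise there. *)
Lemma eigenvalues_power_sum A k :
  \sum_(x <- eigenvalues A) x ^+ k = \tr (A ^+ k).
Proof.
have [|P /unitarymx_unit Pu] := @cotrigonalization C n [:: A].
  by move=> ? ?; rewrite !inE => /eqP-> /eqP->.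
rewrite /= andbT /similar_to conjumx // => tA; set D := _ *m _ in tA.
have sD : perm_eq (eigenvalues A) [seq D i i | i <- enum 'I_n].
  apply: prod_XsubC_eq; rewrite /eigenvalues.
  case: closed_field_poly_normal => s /=.
  rewrite (monicP (char_poly_monic A)) scale1r => <-.
  by rewrite big_map big_enum /= -char_poly_trig // char_poly_conj.
rewrite (perm_big _ sD) /= big_map big_enum /= -(mxtrace_conj (A ^+ k) Pu) -expr_conj //.
by apply: eq_bigr => i _; rewrite (expr_trig k tA).2.
Qed.

End Trigonal.

(** * Characters of a finite abelian group *)

Section CharacterOrthogonality.
Variables (G : finGroupType) (C : numClosedFieldType).
Hypothesis abelG : commutative (@mulg G).
Implicit Types chi psi : {ffun G -> C}.

(** If the characters differ at [h], translating the summation variable by [h] multiplies the sum by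
    [chi h * psi h^-1], which is not 1, so the sum vanishes. *)
Lemma sum_character chi psi : is_character chi -> is_character psi ->
  \sum_g chi g * psi g^-1%g = if chi == psi then #|G|%:R else 0.
Proof.
move=> [chi1 chiM] [psi1 psiM].
have psiV g : psi g * psi g^-1%g = 1 by rewrite -psiM mulgV.
case: eqVneq => [->|ne].
  by rewrite (eq_bigr _ (fun g _ => psiV g)) sumr_const.
have [h neh] : exists h, chi h != psi h.
  apply/existsP; apply: contraNT ne; rewrite negb_exists => /forallP e.
  by apply/eqP/ffunP => h; apply/eqP; rewrite -[_ == _]negbK.
set S := \sum_g _.
have hS : chi h * psi h^-1%g * S = S.
  rewrite mulr_sumr [RHS](reindex_inj (mulgI h)); apply: eq_bigr => g _.
  by rewrite chiM (abelG h g) invMg psiM mulrACA.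
apply/eqP; have /eqP : (chi h * psi h^-1%g - 1) * S = 0.
  by rewrite mulrBl hS mul1r subrr.
rewrite mulf_eq0 subr_eq0 => /orP[|//] /eqP e1; case/eqP: neh.
by rewrite -[LHS]mulr1 -(psiV h) mulrCA e1 mulr1.
Qed.

Definition regular_mx (g : G) : 'M[C]_#|G| :=
  \matrix_(i, j) (enum_val j == enum_val i * g)%g%:R.

Lemma regular_mxM g h : regular_mx (g * h)%g = regular_mx g *m regular_mx h.
Proof.
apply/matrixP => i j; rewrite !mxE.
rewrite (bigD1 (enum_rank (enum_val i * g)%g)) //= big1 => [|k kn].
  by rewrite !mxE enum_rankK eqxx mul1r addr0 mulgA.
rewrite !mxE; case: eqP => [e|]; last by rewrite mul0r.
by rewrite -e enum_valK eqxx in kn.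
Qed.

Lemma regular_mx1 : regular_mx 1%g = 1%:M.
Proof.
by apply/matrixP => i j; rewrite !mxE mulg1 (inj_eq enum_val_inj) eq_sym.
Qed.

Lemma mxtrace_regular g : \tr (regular_mx g) = if g == 1%g then #|G|%:R else 0.
Proof.
rewrite /mxtrace; under eq_bigr do rewrite mxE -{1}[enum_val _]mulg1 (inj_eq (mulgI _)).
rewrite sumr_const card_ord eq_sym; case: eqP => // _.
by rewrite mul0rn.
Qed.

(* The diagonal entries of the simultaneously triangularised regular
   representation are characters; the trace counts each exactly once. *)
Lemma characters_family : exists chi : 'I_#|G| -> {ffun G -> C},
  [/\ forall i, is_character (chi i), injective chi,
      forall psi, is_character psi -> exists i, psi = chi i &
      forall g, \sum_i chi i g = if g == 1%g then #|G|%:R else 0].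
Proof.
have [|P /unitarymx_unit Pu /allP tP] :=
    @cotrigonalization C _ [seq regular_mx g | g <- enum G].
  move=> _ _ /mapP[g _ ->] /mapP[h _ ->].
  by rewrite /comm_mx -!regular_mxM abelG.
pose D g := P *m regular_mx g *m invmx P.
have tD g : is_trig_mx (D g).
  by have := tP _ (map_f _ (mem_enum G g)); rewrite /= /similar_to conjumx.
have DM g h : D (g * h)%g = D g *m D h.
  by rewrite /D regular_mxM !mulmxA mulmxKV.
pose chi i := [ffun g => D g i i].
have chiP i : is_character (chi i).
  split=> [|g h]; rewrite !ffunE.
    by rewrite /D regular_mx1 mulmx1 mulmxV // mxE eqxx.
  by rewrite DM mulmx_trig_diag.
have sum_chi g : \sum_i chi i g = if g == 1%g then #|G|%:R else 0.
  rewrite -mxtrace_regular -(mxtrace_conj (regular_mx g) Pu).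
  by apply: eq_bigr => i _; rewrite ffunE.
have card_chi psi : is_character psi -> #|[set i | chi i == psi]| = 1%N.
  move=> psiP.
  have G0 : #|G|%:R != 0 :> C.
    by rewrite pnatr_eq0 -lt0n; apply/card_gt0P; exists 1%g.
  apply/eqP; rewrite -(eqr_nat C) -(inj_eq (mulfI G0)) mulr1; apply/eqP.
  (* By orthogonality this double sum is [#|G|] for each [i] with [chi i = psi]. Summed over [i]
     first, only [g = 1] survives, and the total is [#|G|]. *)
  transitivity (\sum_i \sum_g chi i g * psi g^-1%g).
    under eq_bigr do rewrite sum_character //.
    by rewrite -big_mkcond sumr_const mulr_natr cardsE.
  rewrite exchange_big /=; under eq_bigr do rewrite -mulr_suml sum_chi.
  rewrite (bigD1 1%g) //= eqxx big1 => [|g /negPf ->]; last by rewrite mul0r.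
  by rewrite invg1 psiP.1 mulr1 addr0.
exists chi; split=> // [i j eij|psi /card_chi c1].
  have /eqP/cards1P[k ek] := card_chi _ (chiP j).
  have : i \in [set k] by rewrite -ek inE eij.
  have : j \in [set k] by rewrite -ek inE.
  by rewrite !inE => /eqP-> /eqP->.
have /eqP/cards1P[i /setP/(_ i)] := c1.
by rewrite !inE eqxx => /eqP <-; exists i.
Qed.

End CharacterOrthogonality.

(** * Lifting of units modulo annihilators, and cyclic submodules *)

(** Two positive powers of [a] coincide by the pigeonhole principle, so the powers are eventually
    periodic. *)
Lemma idempotent_power (R : finComPzRingType) (a : R) :
  exists k, a ^+ k.+1 * a ^+ k.+1 = a ^+ k.+1.
Proof.
have /injectivePn[i [j ij eij]] :
    ~~ injectiveb (fun i : 'I_#|R|.+1 => a ^+ i.+1).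
  by apply/injectiveP => /leq_card; rewrite card_ord ltnn.
wlog lt_ij : i j ij eij / (i < j)%N => [wl|].
  have := ij; rewrite -val_eqE neq_ltn => /orP[|]; first exact: wl.
  by apply: wl; rewrite 1?eq_sym // eij.
pose p := (j - i)%N; have p0 : (0 < p)%N by rewrite subn_gt0.
have per q x : (i < x)%N -> a ^+ (x + q * p) = a ^+ x.
  move=> ix; elim: q => [|q IH]; first by rewrite addn0.
  rewrite mulSn addnCA addnC -addnA -/p.
  have -> : (x + (q * p + p) = (x + q * p - i.+1) + (i.+1 + p))%N.
    by rewrite addnA [RHS]addnA subnK // (leq_trans ix) ?leq_addr.
  rewrite exprD addSn /p subnKC ?(ltnW lt_ij) // -eij -exprD subnK ?IH //.
  by rewrite (leq_trans ix) ?leq_addr.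
(* The exponent [i.+1 * p] is a multiple of the period and lies beyond the preperiod, so doubling it
   does not change the power. *)
exists (i.+1 * p).-1; rewrite prednK ?muln_gt0 // -exprD per //.
by rewrite leq_pmulr.
Qed.

Section Cyclic.
Variables (R : finComPzRingType) (V : finModType R).
Implicit Types (W : {set V}) (x y w : V) (a b r s : R).

(* Some power [e] of [a] is idempotent and congruent to 1; then [a] acts
   invertibly on [e R], and [a * e + (1 - e)] is a unit congruent to [a]. *)
Lemma ann_unit_lift W a b : a * b - 1 \in ann W ->
  exists u : 'U(R), uval u - a \in ann W.
Proof.
move=> abW; have [k] := idempotent_power a; set e := a ^+ k.+1 => ee.
have abkW : (a * b) ^+ k.+1 - 1 \in ann W by rewrite subrX1 mulrC annMr.
have e1W : e - 1 \in ann W.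
  (* The factor [(a * b) ^+ k.+1] contains [e], and [(e - 1) * e = 0]. *)
  have -> : e - 1 = - ((e - 1) * ((a * b) ^+ k.+1 - 1)).
    rewrite exprMn -/e mulrBr mulr1 mulrA mulrBl ee mul1r subrr mul0r.
    by rewrite sub0r opprK.
  by rewrite rpredN annMr.
have un : is_unit (a * e + (1 - e)).
  have e0 : e * (1 - e) = 0 by rewrite mulrBr mulr1 ee subrr.
  have e1 : (1 - e) * (1 - e) = 1 - e by rewrite mulrBl e0 subr0 mul1r.
  have ef : e + (1 - e) = 1 by rewrite addrC subrK.
  move: (1 - e) e0 e1 ef => f e0 e1 ef.
  (* On the summand [e R], [a ^+ k] inverts [a] because [a ^+ k.+1 = e] is the identity there; on
     [f R] the element acts as 1. *)
  apply/is_unitP; exists (a ^+ k * e + f).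
  rewrite mulrDl !mulrDr e1 mulrACA -exprS -/e !ee.
  by rewrite -mulrA e0 mulr0 addr0 [f * _]mulrC -mulrA e0 mulr0 add0r.
exists (UGroup un) => /=.
have -> : a * e + (1 - e) - a = (a - 1) * (e - 1).
  by rewrite mulrBr mulr1 mulrBl mul1r opprB !addrA; congr (_ - a); rewrite addrAC.
exact: annMr.
Qed.

(** Units modulo [ann W] lift to units of [R], so membership becomes invertibility modulo
    [ann W]. *)
Lemma units_plus_annP W a :
  reflect (exists b, a * b - 1 \in ann W) (a \in units_plus_ann W).
Proof.
rewrite inE; apply: (iffP existsP) => [[u /exists_inP[s sW /eqP ->]]|[b]].
  have /is_unitP[y uy] := valP u; exists y.
  by rewrite mulrDl uy addrAC subrr add0r mulrC annMr.
move=> /ann_unit_lift[u uW]; exists u; apply/exists_inP; exists (a - uval u).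
  by rewrite -opprB rpredN.
by rewrite addrC subrK.
Qed.

(** A divisor of a unit modulo [ann W] is again a unit. This equivalence is what keeps a character
    multiplicative when it is extended by zero. *)
Lemma units_plus_annM W a b :
  (a * b \in units_plus_ann W) = (a \in units_plus_ann W) && (b \in units_plus_ann W).
Proof.
apply/units_plus_annP/andP => [[c abc]|[/units_plus_annP[c ac]]].
  by split; apply/units_plus_annP; [exists (b * c) | exists (a * c)];
    rewrite mulrA 1?[b * a]mulrC.
move=> /units_plus_annP[d bd]; exists (c * d); rewrite mulrACA.
have -> : a * c * (b * d) - 1 = (a * c) * (b * d - 1) + (a * c - 1).
  by rewrite mulrBr mulr1 addrA subrK.
by rewrite rpredD ?annMr.
Qed.

Definition span1 x : {set V} := [set r *: x | r : R].

Lemma span1P x y : reflect (exists r, y = r *: x) (y \in span1 x).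
Proof.
by apply: (iffP imsetP) => [[r _ ->]|[r ->]]; [exists r | exists r].
Qed.

Lemma span1_id x : x \in span1 x.
Proof. by apply/span1P; exists 1; rewrite scale1r. Qed.

Lemma span1_subset x y : y \in span1 x -> span1 y \subset span1 x.
Proof.
move=> /span1P[r ->]; apply/subsetP => z /span1P[s ->]; apply/span1P.
by exists (s * r); rewrite scalerA.
Qed.

Lemma ann_span1 x r : (r \in ann (span1 x)) = (r *: x == 0).
Proof.
apply/annP/eqP => [|rx z /span1P[s ->]]; first by apply; exact: span1_id.
by rewrite scalerA mulrC -scalerA rx scaler0.
Qed.

Lemma span1_cyclic x : span1 x \in cyclic_submodules V.
Proof. exact: imset_f. Qed.

Lemma cyclicP W : reflect (exists x, W = span1 x) (W \in cyclic_submodules V).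
Proof.
by apply: (iffP imsetP) => [[x _ ->]|[x ->]]; exists x.
Qed.

Definition generators W := [set x | span1 x == W].

Lemma ann_generators W a x : x \in generators W -> (a - 1 \in ann W) = (a *: x == x).
Proof. by rewrite inE => /eqP <-; rewrite ann_span1 scalerBl scale1r subr_eq0. Qed.

(** For a fixed generator [w], the map sending [r] to [r *: w] identifies R / ann W with [W], and
    units correspond to generators. The case [W = 0] is covered by the trivial unit group of the
    zero ring. *)
Lemma card_generators W : W \in cyclic_submodules V ->
  #|generators W| = #|{: 'U(quot_ann W)}|.
Proof.
move=> /cyclicP[w eW].
pose f (g : 'U(quot_ann W)) : V := quot_repr (uval g) *: w.
have piE r s : (r *: w == s *: w) = (\pi_(quot_ann W) r == \pi_(quot_ann W) s)%qT.
  by rewrite -subr_eq0 -scalerBl -ann_span1 -eW; apply/quot_annP/eqP.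
have reprE (g : quot_ann W) r : (\pi_(quot_ann W) r)%qT = g ->
    quot_repr g *: w = r *: w.
  by move=> <-; apply/eqP; rewrite piE quot_reprK.
have f_inj : injective f.
  by move=> g h /eqP; rewrite piE !quot_reprK => /eqP/val_inj.
rewrite -(card_imset _ f_inj); apply: eq_card => x.
rewrite inE [X in _ == X]eW; apply/eqP/imsetP => [xw|[g _ ->]].
  have /span1P[r er] : x \in span1 w by rewrite -xw span1_id.
  have /span1P[s es] : w \in span1 x by rewrite xw span1_id.
  have ur : is_unit (\pi_(quot_ann W) r : quot_ann W)%qT.
    apply/is_unitP; exists (\pi_(quot_ann W) s)%qT.
    rewrite -[LHS]pi_qmul; apply/eqP; rewrite -piE.
    by rewrite mulrC -scalerA -er -es scale1r.
  by exists (UGroup ur); rewrite // /f (reprE _ r).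
have /is_unitP[h gh] := valP g.
apply/eqP; rewrite eqEsubset !span1_subset //; last first.
  by apply/span1P; exists (quot_repr (uval g)).
apply/span1P; exists (quot_repr h); rewrite /f scalerA mulrC -[LHS]scale1r.
apply/eqP; rewrite piE; apply/eqP; rewrite pi_qmul !quot_reprK.
exact/esym.
Qed.

Lemma submod_iso_ann W W' : submod_iso W W' -> W \in cyclic_submodules V ->
  ann W =i ann W'.
Proof.
move=> /existsP[f /and3P[/eqP <- /forallP fI /forallP fL]] /cyclicP[w eW] r.
have W0 : 0 \in W by rewrite eW; apply/span1P; exists 0; rewrite scale0r.
have f0 : f 0 = 0.
  have /forall_inP/(_ _ W0)/forall_inP/(_ _ W0)/eqP := fL 1.
  by rewrite scaler0 addr0 scale1r => /eqP; rewrite -subr_eq subrr => /eqP.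
have fZ s x : x \in W -> f (s *: x) = s *: f x.
  move=> xW; have /forall_inP/(_ _ xW)/forall_inP/(_ _ W0)/eqP := fL s.
  by rewrite f0 !addr0.
apply/annP/annP => h.
  by move=> _ /imsetP[x xW ->]; rewrite -fZ // h.
move=> x xW; have rxW : r *: x \in W.
  by move: xW; rewrite eW => /span1P[s ->]; apply/span1P; exists (r * s); rewrite scalerA.
have /implyP/(_ rxW)/forall_inP/(_ _ W0)/implyP e := fI (r *: x).
by apply/eqP/e; rewrite f0 fZ // h // imset_f.
Qed.

Lemma scale_span1_eq w w' : ann (span1 w) =i ann (span1 w') ->
  forall r s, (r *: w == s *: w) = (r *: w' == s *: w').
Proof.
move=> aE r s.
by rewrite -subr_eq0 -scalerBl -ann_span1 aE ann_span1 scalerBl subr_eq0.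
Qed.

Lemma span1_map w w' : ann (span1 w) =i ann (span1 w') ->
  exists f : {ffun V -> V}, forall r, f (r *: w) = r *: w'.
Proof.
move=> /scale_span1_eq ZE.
(* Any coefficient may be picked, since equal annihilators make [r *: w'] depend only on [r *: w]; 0
   is a default outside [span1 w]. *)
exists [ffun x => if [pick r | x == r *: w] is Some r then r *: w' else 0] => r.
rewrite ffunE; case: pickP => [s|/(_ r)]; last by rewrite eqxx.
by rewrite ZE => /eqP.
Qed.

(** A cyclic module is a quotient of [R] by its annihilator, which therefore determines its
    isomorphism class. *)
Lemma submod_isoP W W' : W \in cyclic_submodules V -> W' \in cyclic_submodules V ->
  reflect (ann W =i ann W') (submod_iso W W').
Proof.
move=> cW cW'; apply: (iffP idP) => [i|]; first exact: submod_iso_ann.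
move: cW cW' => /cyclicP[w eW] /cyclicP[w' eW']; rewrite eW eW' => aE.
have ZE := scale_span1_eq aE; have [f fE] := span1_map aE.
apply/existsP; exists f; apply/and3P; split.
- apply/eqP/setP => x; apply/imsetP/span1P => [[y /span1P[r ->] ->]|].
    by exists r; rewrite fE.
  by move=> [r ->]; exists (r *: w); rewrite ?fE //; apply/span1P; exists r.
- apply/forall_inP => x /span1P[r ->].
  apply/forall_inP => y /span1P[s ->]; apply/implyP.
  by rewrite !fE -ZE.
- apply/forallP => t; apply/forall_inP => x /span1P[r ->].
  apply/forall_inP => y /span1P[s ->].
  by rewrite scalerA -scalerDl !fE scalerA -scalerDl.
Qed.

(** The map from [r *: w] to [r *: w'] carries generators injectively to generators. Working inside
    [V] avoids comparing the distinct types [quot_ann W] and [quot_ann W']. *)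
Lemma card_generators_le W W' : W \in cyclic_submodules V ->
  W' \in cyclic_submodules V -> ann W =i ann W' ->
  (#|generators W| <= #|generators W'|)%N.
Proof.
move=> /cyclicP[w ->] /cyclicP[w' ->] aE.
have ZE := scale_span1_eq aE; have [f fE] := span1_map aE.
have genE x : x \in generators (span1 w) -> exists2 r, x = r *: w &
    exists s, (s * r) *: w = w.
  rewrite inE => /eqP e; have /span1P[r er] : x \in span1 w by rewrite -e span1_id.
  have /span1P[s es] : w \in span1 x by rewrite e span1_id.
  by exists r => //; exists s; rewrite -scalerA -er.
have f_inj : {in generators (span1 w) &, injective f}.
  move=> x y /genE[r -> _] /genE[s -> _]; rewrite !fE => /eqP.
  by rewrite -ZE => /eqP.
rewrite -(card_in_imset f_inj); apply/subset_leq_card/subsetP.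
move=> _ /imsetP[_ /genE[r -> [s srw]] ->]; rewrite fE inE eqEsubset.
rewrite !span1_subset //; last by apply/span1P; exists r.
apply/span1P; exists s; rewrite scalerA; apply/eqP.
by rewrite -[X in X == _]scale1r -ZE srw scale1r.
Qed.

Lemma card_generators_ann W W' : W \in cyclic_submodules V ->
  W' \in cyclic_submodules V -> ann W =i ann W' -> #|generators W| = #|generators W'|.
Proof.
by move=> cW cW' aE; apply/eqP; rewrite eqn_leq !card_generators_le.
Qed.

(** Isomorphism is equality of annihilators, hence an equivalence relation; so the isomorphism
    classes partition the cyclic submodules. *)
Lemma iso_copies_class W W' : W \in cyclic_submodules V ->
  W' \in iso_copies W -> iso_copies W' = iso_copies W.
Proof.
move=> cW; rewrite inE => /andP[cW' /(submod_isoP cW cW') aE].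
apply/setP => X; rewrite !inE; case: (boolP (X \in _)) => //= cX.
by apply/submod_isoP/submod_isoP => // e r; rewrite ?aE ?e // -aE.
Qed.

Lemma iso_copies_refl W : W \in cyclic_submodules V -> W \in iso_copies W.
Proof. by move=> cW; rewrite inE cW; apply/submod_isoP. Qed.

End Cyclic.

(** * Characters factoring through the units modulo an annihilator *)

Section CharacterSums.
Variables (C : numClosedFieldType) (R : finComPzRingType) (V : finModType R).
Variable W : {set V}.
Local Notation Q := (quot_ann W).

Lemma ugroup_mulC (S : finComPzRingType) : commutative (@mulg 'U(S)).
Proof. by move=> g h; apply: val_inj; rewrite /= mulrC. Qed.

Lemma pi_annM (g h : 'U(R)) : pi_ann W (g * h)%g = (pi_ann W g * pi_ann W h)%g.
Proof. by apply: val_inj; rewrite /= [LHS]pi_qmul. Qed.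

Lemma pi_ann1 : pi_ann W 1%g = 1%g.
Proof. exact: val_inj. Qed.

(** Surjectivity ensures that distinct characters of the quotient unit group pull back to distinct
    characters of U(R). *)
Lemma pi_ann_surj (g : 'U(Q)) : exists h, pi_ann W h = g.
Proof.
have /is_unitP[g' gg'] := valP g.
have /ann_unit_lift[h hW] : quot_repr (uval g) * quot_repr g' - 1 \in ann W.
  by apply/quot_annP; rewrite pi_qmul !quot_reprK.
exists h; apply: val_inj => /=.
by rewrite -[RHS]quot_reprK; apply/quot_annP.
Qed.

Lemma characters_throughP (rho : {ffun 'U(R) -> C}) :
  reflect (exists2 sigma : {ffun 'U(Q) -> C}, is_character sigma &
             rho = [ffun h => sigma (pi_ann W h)])
    (rho \in characters_through C W).
Proof.
(* Finiteness is what gives [fset_set] its intended elements. *)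
have fin : finite_set [set rho : {ffun 'U(R) -> C} |
    is_character rho /\ factors_through W rho]%classic.
  by apply: sub_finite_set (finite_characters _ C) => ? [].
rewrite /characters_through in_fset_set //; apply: (iffP idP) => [|[sigma sP ->]].
  move=> /set_mem[_ [sigma [[s1 sM] rE]]]; exists (finfun sigma).
    by split=> [|g h]; rewrite !ffunE.
  by apply/ffunP => h; rewrite !ffunE.
case: (sP) => s1 sM; apply/mem_set; split.
  split=> [|g h]; rewrite !ffunE; first by rewrite pi_ann1.
  by rewrite pi_annM sM.
by exists sigma; split=> // h; rewrite ffunE.
Qed.

(** Pullback along [pi_ann W] is a bijection from the characters of U(R / ann W), so their sum
    formula transfers. *)
Lemma sum_characters_through (h : 'U(R)) :
  \sum_(rho <- characters_through C W) rho h =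
  if pi_ann W h == 1%g then #|{: 'U(Q)}|%:R else 0.
Proof.
have [chi [chiP chi_inj chi_surj <-]] :=
  @characters_family 'U(Q) C (@ugroup_mulC _).
pose f i : {ffun 'U(R) -> C} := [ffun h => chi i (pi_ann W h)].
have f_inj : injective f.
  move=> i j /ffunP eij; apply: chi_inj; apply/ffunP => g.
  by have [k <-] := pi_ann_surj g; have := eij k; rewrite !ffunE.
have pe : perm_eq (characters_through C W) [seq f i | i <- enum 'I_#|{: 'U(Q)}|].
  apply: uniq_perm => [||rho]; first exact: fset_uniq.
    by rewrite map_inj_uniq ?enum_uniq.
  apply/characters_throughP/mapP => [[s /chi_surj[i ->] ->]|[i _ ->]].
    by exists i; rewrite ?mem_enum.
  by exists (chi i).
rewrite (perm_big _ pe) big_map big_enum /=.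
by apply: eq_bigr => i _; rewrite ffunE.
Qed.

Section Extension.
Variable v : R -> 'U(R).
Hypothesis vP : forall a, a \in units_plus_ann W ->
  (uval (v a) = a %[mod Q])%qT.

(** The analogue of a Dirichlet character modulo [ann W]. *)
Definition char_ext (rho : {ffun 'U(R) -> C}) (a : R) : C :=
  if a \in units_plus_ann W then rho (v a) else 0.

Lemma units_plus_ann1 a : a - 1 \in ann W -> a \in units_plus_ann W.
Proof. by move=> aW; apply/units_plus_annP; exists 1; rewrite mulr1. Qed.

Lemma pi_ann_eq1 a : a \in units_plus_ann W ->
  (pi_ann W (v a) == 1%g) = (a - 1 \in ann W).
Proof.
move=> aU; rewrite -val_eqE /= vP //.
by apply/eqP/quot_annP.
Qed.

Lemma char_ext1 rho : rho \in characters_through C W -> char_ext rho 1 = 1.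
Proof.
have U1 : 1 \in units_plus_ann W by rewrite units_plus_ann1 // subrr rpred0.
move=> /characters_throughP[s [s1 _] ->]; rewrite /char_ext U1 ffunE.
by have := pi_ann_eq1 U1; rewrite subrr rpred0 => /eqP ->.
Qed.

Lemma char_extM rho a b : rho \in characters_through C W ->
  char_ext rho (a * b) = char_ext rho a * char_ext rho b.
Proof.
move=> /characters_throughP[s [_ sM] ->]; rewrite /char_ext units_plus_annM.
case: (boolP (a \in _)) => aU; last by rewrite mul0r.
case: (boolP (b \in _)) => bU /=; last by rewrite mulr0.
(* The lifts [v (a * b)] and [v a * v b] need only agree modulo [ann W], because the character
   factors through the quotient. *)
rewrite !ffunE -sM; congr (s _); apply: val_inj => /=.
by rewrite !vP ?units_plus_annM ?aU // [LHS]pi_qmul.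
Qed.

Lemma sum_char_ext a : W \in cyclic_submodules V ->
  \sum_(rho <- characters_through C W) char_ext rho a =
  (#|generators W| * (a - 1 \in ann W))%:R.
Proof.
move=> cW; rewrite /char_ext.
case: (boolP (a \in units_plus_ann W)) => aU; last first.
  rewrite big1 //; case: (boolP (a - 1 \in ann W)); last by rewrite muln0.
  by move=> /units_plus_ann1; rewrite (negPf aU).
rewrite sum_characters_through pi_ann_eq1 // card_generators //.
by case: (_ \in _); rewrite ?muln1 ?muln0.
Qed.

End Extension.
End CharacterSums.

(** * Multiplicative convolution and the multiplication walk *)

Section Convolution.
Variables (C : comNzRingType) (R : finComPzRingType) (q : R -> C).

Fixpoint mconv n : R -> C :=
  if n is n'.+1 then fun a => \sum_b q b * \sum_(c | b * c == a) mconv n' c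
  else fun a => (a == 1)%:R.

Lemma sum_mconv0 (h : R -> C) : \sum_a mconv 0 a * h a = h 1.
Proof.
rewrite (bigD1 1) //= eqxx mul1r big1 ?addr0 // => a /negPf ->.
by rewrite mul0r.
Qed.

(** The recursion in integrated form, against a test function [h]; the convolution is used only
    through such sums. *)
Lemma sum_mconvS n (h : R -> C) :
  \sum_a mconv n.+1 a * h a = \sum_b q b * \sum_c mconv n c * h (b * c).
Proof.
under eq_bigr do rewrite /= mulr_suml.
rewrite exchange_big /=; apply: eq_bigr => b _.
rewrite [in RHS](partition_big (fun c => b * c) xpredT) //= mulr_sumr.
apply: eq_bigr => a _; rewrite -mulrA; congr (_ * _); rewrite mulr_suml.
by apply: eq_bigr => c /eqP ->.
Qed.

Lemma sum_mconv_morph n (h : R -> C) : h 1 = 1 ->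
  (forall a b, h (a * b) = h a * h b) ->
  \sum_a mconv n a * h a = (\sum_a q a * h a) ^+ n.
Proof.
move=> h1 hM; elim: n => [|n IH]; first by rewrite sum_mconv0 h1.
rewrite sum_mconvS exprS -IH mulr_suml; apply: eq_bigr => b _.
rewrite -mulrA; congr (_ * _); rewrite mulr_sumr; apply: eq_bigr => c _.
by rewrite hM mulrCA.
Qed.

Lemma sum_mconv n : \sum_a q a = 1 -> \sum_a mconv n a = 1.
Proof.
move=> q1; transitivity (\sum_a mconv n a * 1).
  by apply: eq_bigr => a _; rewrite mulr1.
rewrite (@sum_mconv_morph n (fun=> 1)) // => [|_ _]; last by rewrite mulr1.
by under eq_bigr do rewrite mulr1; rewrite q1 expr1n.
Qed.

Variable V : finModType R.

Definition mult_mx : 'M[C]_#|{: V}| :=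
  \matrix_(i, j) \sum_(a : R | a *: (enum_val i : V) == enum_val j) q a.

Lemma mult_mxX n i j : (mult_mx ^+ n) i j =
  \sum_a mconv n a * (a *: (enum_val i : V) == enum_val j)%:R.
Proof.
elim: n i j => [|n IH] i j.
  rewrite sum_mconv0 scale1r (inj_eq enum_val_inj) expr0.
  by rewrite -[LHS]/((1%:M : 'M_#|{: V}|) i j) mxE.
rewrite exprS -mulmxE mxE sum_mconvS.
under eq_bigr => k _ do rewrite mxE mulr_suml.
rewrite (exchange_big_dep xpredT) //=; apply: eq_bigr => b _.
(* Given the first multiplier [b], the intermediate state is forced. *)
rewrite (bigD1 (enum_rank (b *: enum_val i))) /= ?enum_rankK //.
rewrite big1 => [|k /andP[/eqP ->]]; last by rewrite enum_valK eqxx.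
rewrite addr0 IH enum_rankK; congr (_ * _).
by apply: eq_bigr => c _; rewrite scalerA [b * c]mulrC.
Qed.

Lemma mult_mx_const : \sum_a q a = 1 ->
  mult_mx *m const_mx 1 = const_mx 1 :> 'cV_#|{: V}|.
Proof.
move=> q1; apply/colP => i; rewrite !mxE -[RHS]q1.
rewrite [RHS](partition_big (fun a => enum_rank (a *: enum_val i)) xpredT) //=.
apply: eq_bigr => j _; rewrite !mxE mulr1; apply: eq_bigl => a.
by apply/eqP/eqP => [->|<-]; rewrite ?enum_valK ?enum_rankK.
Qed.

(** A vector is fixed by [a] exactly when [a - 1] annihilates the module it generates, so the
    generators of one [W] are fixed all together or not at all. *)
Lemma mxtrace_mult_mxX n : \tr (mult_mx ^+ n) =
  \sum_(W in cyclic_submodules V)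
    \sum_a mconv n a * (#|generators W| * (a - 1 \in ann W))%:R.
Proof.
transitivity (\sum_(x : V) \sum_a mconv n a * (a *: x == x)%:R).
  rewrite [RHS](reindex _ (onW_bij _ (@enum_val_bij _))) /=.
  by apply: eq_bigr => i _; rewrite mult_mxX.
rewrite (partition_big (@span1 R V) (mem (cyclic_submodules V))) /=; last first.
  by move=> x _; apply: span1_cyclic.
apply: eq_bigr => W _; rewrite exchange_big /=; apply: eq_bigr => a _.
rewrite -mulr_sumr natrM; congr (_ * _).
rewrite -sum1_card natr_sum mulr_suml; apply: eq_big => x; first by rewrite inE.
by move=> xW; rewrite mul1r (@ann_generators _ _ _ a x) // inE.
Qed.

End Convolution.

(* Both [M] and [T] fix [J], so [T ^+ k - b ^+ k *: M ^+ k] stays of the form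
   [J *m Y], where [Y *m J] is forced by [T ^+ k *m J = J]. *)
Lemma mxtrace_rank1_perturbation (F : comNzRingType) m (M : 'M[F]_m) (b : F)
    (e : 'rV_m) (T := b *: M + const_mx 1 *m e) k : (0 < m)%N ->
  M *m const_mx 1 = const_mx 1 :> 'cV_m -> T *m const_mx 1 = const_mx 1 :> 'cV_m ->
  \tr (T ^+ k) = b ^+ k * (\tr (M ^+ k) - 1) + 1.
Proof.
move=> m0; pose J : 'cV[F]_m := const_mx 1; rewrite -/J => MJ TJ.
have fixX (A : 'M[F]_m) : A *m J = J -> A ^+ k *m J = J.
  move=> AJ; elim: k => [|j IH]; first exact: mul1mx.
  by rewrite exprS -mulmxE -mulmxA IH.
have [Y TY] : exists Y, T ^+ k = b ^+ k *: M ^+ k + J *m Y.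
  elim: k {fixX} => [|j [Y IH]]; first by exists 0; rewrite !expr0 scale1r mulmx0 addr0.
  exists (b ^+ j *: (e *m M ^+ j) + Y).
  rewrite exprS IH -mulmxE mulmxDr mulmxA TJ mulmxDr addrA; congr (_ + _).
  rewrite -scalemxAr mulmxDl -scalemxAl scalerDr scalerA -exprSr -mulmxA.
  by rewrite [M ^+ j.+1]exprS -[J *m (_ *: _)]scalemxAr.
rewrite TY mxtraceD mxtraceZ mxtrace_mulC.
have := fixX _ TJ; rewrite TY mulmxDl -scalemxAl fixX // -mulmxA.
rewrite [Y *m J]mx11_scalar mxtrace_scalar mul_mx_scalar.
(* Every row gives the same scalar equation, [b ^+ k] plus the entry of [Y *m J] equals 1;
   positivity of [m] supplies a row. *)
move=> /matrixP/(_ (Ordinal m0) 0); rewrite !mxE !mulr1 => eY.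
by rewrite mulrBr mulr1 -addrA; congr (_ + _); rewrite -eY addrA addNr add0r.
Qed.

(** * Comparison of traces with sums of powers of [lambda] *)

Section Spectrum.
Variables (K : realType) (R : finComPzRingType) (V : finModType R).
Variables (Q : R -> K) (alpha : K).
Hypothesis sumQ : \sum_a Q a = 1.
Local Notation q := (fun a => (Q a)%:C%C).
Local Notation beta := ((1 - alpha)%:C%C).

(** The common value of two quantities: the share of [W] in the trace of the [n]-th power, and the
    sum of the [n]-th powers of the [lambda] attached to [W]. *)
Definition class_power_sum n (W : {set V}) : K[i]%C :=
  if W == [set 0] then 1 else beta ^+ n *
    \sum_a mconv q n a * (#|generators W| * (a - 1 \in ann W))%:R.

Lemma span10 : span1 (0 : V) = [set 0].
Proof.
apply/setP => x; rewrite inE; apply/span1P/eqP => [[r ->]|->].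
  by rewrite scaler0.
by exists 0; rewrite scaler0.
Qed.

Lemma generators0 : generators [set 0 : V] = [set 0].
Proof.
apply/setP => x; rewrite !inE; apply/eqP/eqP => [e|->]; last exact: span10.
by have := span1_id x; rewrite e inE => /eqP.
Qed.

Lemma ann0 a : a \in ann [set 0 : V].
Proof. by apply/annP => x; rewrite inE => /eqP ->; rewrite scaler0. Qed.

(** Expresses the case distinction of [class_power_sum] through the annihilator, so that it is
    invariant under isomorphism. *)
Lemma ann_zeroP (W : {set V}) : W \in cyclic_submodules V ->
  (W == [set 0]) = (1 \in ann W).
Proof.
move=> /cyclicP[w ->]; apply/eqP/idP => [->|]; first exact: ann0.
by rewrite ann_span1 scale1r => /eqP ->; exact: span10.
Qed.

Lemma class_power_sum_ann n (W W' : {set V}) : W \in cyclic_submodules V ->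
  W' \in cyclic_submodules V -> ann W =i ann W' ->
  class_power_sum n W = class_power_sum n W'.
Proof.
move=> cW cW' aE; rewrite /class_power_sum !ann_zeroP // aE; case: ifP => // _.
by congr (_ * _); apply: eq_bigr => a _; rewrite aE (card_generators_ann cW cW').
Qed.

Lemma lambda_power_sum n (W : {set V}) (v : R -> 'U(R)) :
  W \in cyclic_submodules V ->
  (forall a, a \in units_plus_ann W -> (uval (v a) = a %[mod quot_ann W])%qT) ->
  \sum_(rho <- characters_through K[i]%C W) lambda alpha Q W v rho ^+ n =
  class_power_sum n W.
Proof.
move=> cW vP; rewrite /class_power_sum /lambda; case: eqVneq => [W0|_].
  (* For [W = 0] every term is 1, and orthogonality at 1 counts a single character because 0 has a
     single generator. *)
  have := sum_char_ext K[i]%C vP 1 cW.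
  rewrite {3 4}W0 generators0 cards1 ann0 => e1.
  rewrite -[RHS]e1 !big_seq; apply: eq_bigr => rho rW.
  by rewrite char_ext1 // expr1n.
(* Orthogonality read backwards turns generator counts into sums of extended characters, whose
   convolution averages are [n]-th powers. *)
under [in RHS]eq_bigr do rewrite -(sum_char_ext _ vP) // mulr_sumr.
rewrite exchange_big mulr_sumr !big_seq; apply: eq_bigr => rho rW.
rewrite sum_mconv_morph; last first.
- by move=> a b; apply: char_extM.
- exact: char_ext1.
rewrite exprMn big_mkcond /=; congr (_ * _ ^+ _); apply: eq_bigr => a _.
by rewrite /char_ext; case: ifP; rewrite ?mulr0.
Qed.

Lemma sumq : \sum_a q a = 1.
Proof. by rewrite -(rmorph_sum (real_complex K)) sumQ. Qed.

Lemma transition_matrixE :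
  transition_matrix alpha (uniform K : V -> K) Q =
  beta *: mult_mx q V +
  (const_mx 1 : 'cV_#|{: V}|) *m const_mx (alpha / #|{: V}|%:R)%:C%C.
Proof.
apply/matrixP => i j; rewrite !mxE big_ord1 !mxE mul1r addrC.
rewrite /coin_toss /uniform rmorphD /=; congr (_ + _); last first.
  by rewrite rmorphM rmorph_sum.
(* Exactly one jump leads from one state to another, so the uniform part is a constant matrix. *)
congr (_ * _)%:C%C; rewrite (big_pred1 (enum_val j - enum_val i)) // => b.
by rewrite /= [RHS]eq_sym subr_eq addrC eq_sym.
Qed.

Lemma mxtrace_transitionX n :
  \tr (transition_matrix alpha (uniform K : V -> K) Q ^+ n) =
  \sum_(W in cyclic_submodules V) class_power_sum n W.
Proof.
have V0 : (0 < #|{: V}|)%N by apply/card_gt0P; exists 0.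
rewrite transition_matrixE mxtrace_rank1_perturbation //; last first.
- rewrite mulmxDl -scalemxAl mult_mx_const ?sumq // -mulmxA.
  apply/colP => i; rewrite !mxE big_ord1 !mxE.
  under eq_bigr do rewrite !mxE mulr1.
  rewrite sumr_const card_ord -rmorphMn /= -mulr_natr divfK; last first.
    by rewrite pnatr_eq0 -lt0n.
  by rewrite mul1r mulr1 -rmorphD subrK.
- by rewrite mult_mx_const // sumq.
have c0 : [set 0] \in cyclic_submodules V by rewrite -span10 span1_cyclic.
rewrite mxtrace_mult_mxX (bigD1 _ c0) [RHS](bigD1 _ c0) /=.
(* The share of the zero submodule is the total mass 1, which cancels the [- 1] of the perturbation
   formula; the remaining [+ 1] replaces it. *)
have -> : \sum_a mconv q n a *
    (#|generators [set 0 : V]| * (a - 1 \in ann [set 0 : V]))%:R = 1.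
  rewrite -[RHS](sum_mconv n sumq); apply: eq_bigr => a _.
  by rewrite generators0 cards1 ann0 mulr1.
rewrite {1}/class_power_sum eqxx addrAC subrr add0r addrC mulr_sumr.
congr (_ + _); apply: eq_bigr => W /andP[_ /negPf W0].
by rewrite /class_power_sum W0.
Qed.

End Spectrum.

Theorem theorem4p9 (K : realType) (R : finComPzRingType) (V : finModType R)
    (Q : R -> K) (hQ : is_probability Q)
    (alpha : K) (h0 : 0 <= alpha) (h1 : alpha <= 1)
    (u : {set V} -> R -> 'U(R))
    (hu : forall W a, W \in cyclic_submodules V -> a \in units_plus_ann W ->
       (uval (u W a) = a %[mod quot_ann W])%qT)
    (rep : {set {set V}} -> {set V})
    (hrep : forall c, c \in iso_classes V -> rep c \in c) :
  perm_eq
    (eigenvalues (transition_matrix alpha (uniform K : V -> K) Q))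
    (flatten
       [seq nseq #|iso_copies (rep c)| (lambda alpha Q (rep c) (u (rep c)) rho)
       | c <- enum (iso_classes V), rho <- characters_through K[i]%C (rep c)]).
Proof.
apply: perm_eq_power_sums => n.
rewrite eigenvalues_power_sum mxtrace_transitionX; last exact: hQ.2.
rewrite big_flatten big_allpairs_dep big_enum /=.
rewrite (partition_big (@iso_copies R V) (mem (iso_classes V))) /=; last first.
  by move=> W cW; apply: imset_f.
apply: eq_bigr => c cc.
have /imsetP[W0 cW0 ec] := cc.
have cyc W : W \in c -> W \in cyclic_submodules V by rewrite ec inE => /andP[].
have copies W : W \in c -> iso_copies W = c.
  by move=> Wc; rewrite ec; apply: iso_copies_class; rewrite // -ec.
have rc := hrep _ cc; have crep := cyc _ rc.
(* Contributions are constant on an isomorphism class, so the class counts as [#|c|] copies of its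
   representative. *)
transitivity (\sum_(W in c) class_power_sum Q alpha n (rep c)).
  apply: eq_big => W.
    apply/andP/idP => [[cW /eqP <-]|Wc]; first exact: iso_copies_refl.
    by rewrite cyc // copies.
  move=> /andP[cW /eqP eW]; apply: class_power_sum_ann => //.
  have: rep c \in iso_copies W by rewrite eW.
  by rewrite inE => /andP[_ /submod_isoP]; apply.
rewrite sumr_const -(lambda_power_sum _ _ n crep (fun a => hu _ a crep)).
rewrite copies // -sumrMnl; apply: eq_bigr => rho _.
by rewrite big_nseq iter_addr_0.
Qed.
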